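(* Let $f:X\to X$ be the one-sided full shift on $X=\{0,1\}^{\mathbb N}$. Then for every $m\in\mathbb N$ there exist a continuous potential $\Phi:X\to\mathbb R^m$, a point $w\in\mathrm{Rot}(\Phi)$ and a direction vector $\alpha\in S^{m-1}$ such that $w$ is a smooth exposed point of $\mathrm{Rot}(\Phi)$ with direction vector $\alpha$ (that is, $F_\alpha(\Phi)=\{w\}$ and $\alpha$ is the only direction vector $\beta\in S^{m-1}$ with $w\in H_\beta(\Phi)$), and $GS(\alpha)$ contains two distinct ergodic measures.
   Context: $X$ carries the product topology and $\mathcal M$ denotes the set of $f$-invariant Borel probability measures with the weak$^*$ topology. An equilibrium state of a continuous $\varphi:X\to\mathbb R$ is a $\mu\in\mathcal M$ maximizing $h_\nu(f)+\int\varphi\,d\nu$ over $\nu\in\mathcal M$ ($h_\nu(f)$ is measure-theoretic entropy); $ES(\varphi)$ is the set of these. A ground state of $\varphi$ is a $\mu\in\mathcal M$ for which there are an increasing sequence $t_n\to\infty$ and $\mu_{t_n}\in ES(t_n\varphi)$ with $\mu_{t_n}\to\mu$ weak$^*$. For $\Phi=(\phi_1,\dots,\phi_m)$ continuous, $\mathrm{rv}(\mu)=(\int\phi_1\,d\mu,\dots,\int\phi_m\,d\mu)$ and $\mathrm{Rot}(\Phi)=\{\mathrm{rv}(\mu):\mu\in\mathcal M\}$, a compact convex subset of $\mathbb R^m$. For $\alpha\in S^{m-1}$ (unit sphere of $\mathbb R^m$; direction vectors), $\alpha\cdot\Phi=\sum_i\alpha_i\phi_i$, $GS(\alpha)$ is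 the set of ground states of $\alpha\cdot\Phi$, $H_\alpha(\Phi)=\{u\in\mathbb R^m:\alpha\cdot u=\max_{w\in\mathrm{Rot}(\Phi)}\alpha\cdot w\}$ is the supporting hyperplane with outward normal $\alpha$, and $F_\alpha(\Phi)=\mathrm{Rot}(\Phi)\cap H_\alpha(\Phi)$. *)

(* Defs.v *)
From HB Require Import structures.
From mathcomp Require Import all_boot all_order all_algebra.
From mathcomp Require Import all_classical all_reals all_analysis.

Set Implicit Arguments.
Unset Strict Implicit.
Unset Printing Implicit Defensive.

Import Order.TTheory GRing.Theory Num.Theory numFieldNormedType.Exports.

Local Open Scope classical_set_scope.
Local Open Scope ring_scope.

Definition invariant_measure (R : realType) (d : measure_display)
    (T : measurableType d) (f : T -> T) (mu : probability T R) : Prop :=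
  forall A : set T, measurable A -> mu (f @^-1` A) = mu A.

Definition ergodic_measure (R : realType) (d : measure_display)
    (T : measurableType d) (f : T -> T) (mu : probability T R) : Prop :=
  invariant_measure f mu /\
  forall A : set T, measurable A -> f @^-1` A = A -> mu A = 0%E \/ mu A = 1%E.

(* A library measure is a function on all subsets of the carrier, whose values
   on measurable sets do not determine the others; so equality of measures is
   equality on measurable sets rather than [=]. *)
Definition same_measure (R : realType) (d : measure_display)
    (T : measurableType d) (mu nu : probability T R) : Prop :=
  forall A : set T, measurable A -> mu A = nu A.

(* Blocks are allowed to be empty: they contribute 0 to the entropy. *)
Definition measurable_partition (d : measure_display) (T : measurableType d)
    (k : nat) (A : 'I_k -> set T) : Prop :=
  [/\ forall i, measurable (A i),
      trivIset [set: 'I_k] A &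
      \bigcup_i A i = [set: T]].

(* The block of the join of A, f^-1 A, ..., f^-(n-1) A with itinerary s. *)
Definition join_block (T : Type) (f : T -> T) (k : nat) (A : 'I_k -> set T)
    (n : nat) (s : {ffun 'I_n -> 'I_k}) : set T :=
  [set x | forall i : 'I_n, A (s i) (iter i f x)].

(* [ln 0 = 0] in the library, in accordance with 0 log 0 = 0. *)
Definition join_entropy (R : realType) (d : measure_display)
    (T : measurableType d) (f : T -> T) (mu : probability T R)
    (k : nat) (A : 'I_k -> set T) (n : nat) : R :=
  \sum_(s : {ffun 'I_n -> 'I_k})
    - (fine (mu (join_block f A s)) * ln (fine (mu (join_block f A s)))).

Definition partition_entropy (R : realType) (d : measure_display)
    (T : measurableType d) (f : T -> T) (mu : probability T R)
    (k : nat) (A : 'I_k -> set T) : R :=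
  limn (fun n : nat => join_entropy f mu A n / n%:R).

(* Kolmogorov-Sinai entropy. *)
Definition entropy (R : realType) (d : measure_display)
    (T : measurableType d) (f : T -> T) (mu : probability T R) : \bar R :=
  ereal_sup [set h | exists (k : nat) (A : 'I_k -> set T),
    measurable_partition A /\ h = (partition_entropy f mu A)%:E].

(* [cantor_space] is nat -> bool with the product topology. [borel_cantor] is
   the same carrier with its Borel sigma-algebra; the two types are
   convertible, which is used below to integrate functions on [cantor_space]. *)
Definition borel_cantor := g_sigma_algebraType (@open cantor_space).

Definition full_shift (x : borel_cantor) : borel_cantor := fun n => x n.+1.

Section ShiftInvariant.
Variable R : realType.

Definition invariant_measures : set (probability borel_cantor R) :=
  [set mu | invariant_measure full_shift mu].

Definition equilibrium_states (phi : cantor_space -> R) :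
    set (probability borel_cantor R) :=
  [set mu | invariant_measures mu /\
     forall nu, invariant_measures nu ->
       (entropy full_shift nu + (\int[nu]_x phi x)%:E <=
        entropy full_shift mu + (\int[mu]_x phi x)%:E)%E].

Definition weak_star_cvg (mu_ : nat -> probability borel_cantor R)
    (mu : probability borel_cantor R) : Prop :=
  forall g : cantor_space -> R, continuous g ->
    (fun n => \int[mu_ n]_x g x) @ \oo --> \int[mu]_x g x.

Definition ground_states (phi : cantor_space -> R) :
    set (probability borel_cantor R) :=
  [set mu | invariant_measures mu /\
     exists (t : nat -> R) (mu_ : nat -> probability borel_cantor R),
       [/\ increasing_seq t, t @ \oo --> +oo,
           forall n, equilibrium_states (fun x => t n * phi x) (mu_ n) &
           weak_star_cvg mu_ mu]].

Definition dot (m : nat) (u v : 'rV[R]_m) : R := \sum_(i < m) u 0 i * v 0 i.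

(* The Euclidean sphere; the norm of the library on 'rV[R]_m is the sup norm. *)
Definition unit_sphere (m : nat) : set 'rV[R]_m := [set a | dot a a = 1].

Section RotationSet.
Variables (m : nat) (Phi : cantor_space -> 'rV[R]_m).

Definition rv (mu : probability borel_cantor R) : 'rV[R]_m :=
  \row_(i < m) \int[mu]_x Phi x 0 i.

Definition Rot : set 'rV[R]_m := rv @` invariant_measures.

(* dot alpha u is the maximum of dot alpha over Rot: an attained value and an
   upper bound. *)
Definition supporting_hyperplane (alpha : 'rV[R]_m) : set 'rV[R]_m :=
  [set u | (dot alpha @` Rot) (dot alpha u) /\
           ubound (dot alpha @` Rot) (dot alpha u)].

Definition face (alpha : 'rV[R]_m) : set 'rV[R]_m :=
  Rot `&` supporting_hyperplane alpha.

Definition smooth_exposed_point (w alpha : 'rV[R]_m) : Prop :=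
  face alpha = [set w] /\
  forall beta, unit_sphere beta -> supporting_hyperplane beta w -> beta = alpha.

Definition directional_ground_states (alpha : 'rV[R]_m) :
    set (probability borel_cantor R) :=
  ground_states (fun x => dot alpha (Phi x)).

End RotationSet.
End ShiftInvariant.

(* Main.v *)
(** The first coordinate of the potential is minus the cost of the initial run of
    the point, where the costs along a run of length [r] add up to
    [ln (r (r + 1))]. Coding a symbol sequence by its run lengths, drawn with
    probabilities [1 / (r (r + 1))], shows that the entropy of every invariant
    measure is at most its mean cost. So from inverse temperature 1 on, the Dirac
    masses at [0^oo] and [1^oo] are both equilibrium states, hence both are
    ground states. The mean cost vanishes only on convex combinations of these
    two masses, and the other coordinates vanish at both fixed points, which makes
    the origin exposed. The other coordinates decay more slowly along runs of
    zeros ([sqrt a] against [ln a] on the orbit of [(0^a 1^b)^oo]), the length [b]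
    selecting the coordinate and its sign; no other direction can therefore
    support the rotation set at the origin. *)

From HB Require Import structures.
Require Import Defs.
From mathcomp Require Import all_boot all_order all_algebra.
From mathcomp Require Import all_classical all_reals all_analysis.
From mathcomp Require Import measurable_realfun ring lra zify.
Import Order.TTheory GRing.Theory Num.Theory numFieldNormedType.Exports.
Local Open Scope classical_set_scope.
Local Open Scope ring_scope.

(** * Run lengths of words *)

Fixpoint words (M : nat) : seq (seq bool) :=
  if M is M'.+1 then
    [seq true :: w | w <- words M'] ++ [seq false :: w | w <- words M']
  else [:: [::]].

Fixpoint prefix_word (M : nat) (x : nat -> bool) : seq bool :=
  if M is M'.+1 then x 0 :: prefix_word M' (fun n => x n.+1) else [::].

Lemma prefix_word_in M x : prefix_word M x \in words M.
Proof.
elim: M x => [|M IH] x //=; rewrite mem_cat.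
by case: (x 0); apply/orP; [left|right]; apply: map_f.
Qed.

Lemma nth_prefix_word M x i :
  (i < M)%N -> nth false (prefix_word M x) i = x i.
Proof. by elim: M x i => [|M IH] x [|i] //= iM; rewrite IH. Qed.

Fixpoint word_run (w : seq bool) : nat :=
  if w is d :: w' then
    if ohead w' == Some d then (word_run w').+1 else 1
  else 0.

(** The alternative [r = M] covers a run cut off by the end of the word: it is counted with its
    truncated length. *)
Lemma word_run_prefix M r (x : nat -> bool) :
  (0 < r <= M)%N -> (forall i, (i < r)%N -> x i = x 0) ->
  (r = M \/ x r != x 0) -> word_run (prefix_word M x) = r.
Proof.
elim: M r x => [|M IH] [|[|r]] x //= rM xr h.
  case: M IH rM h => [//|M] IH rM [//|h] /=.
  rewrite ifF //; apply/negP => /eqP[h']; by rewrite h' eqxx in h.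
case: M IH rM h => [|M] IH rM h; first by lia.
have x10 : x 1%N = x 0 by exact: xr.
rewrite [ohead _]/= x10 eqxx; congr _.+1.
apply: (IH r.+1) => //= [i ir|]; first by rewrite x10; apply: xr.
by rewrite x10; case: h => [[->]|h]; [left|right].
Qed.

(* The value [0] encodes an infinite initial run. *)
Definition run (x : nat -> bool) : nat :=
  if pselect (exists n, x n != x 0) is left h then ex_minn h else 0.

Lemma run_const x : (forall n, x n = x 0) -> run x = 0.
Proof.
move=> h; rewrite /run; case: pselect => // e.
by exfalso; case: e => n; rewrite h eqxx.
Qed.

Lemma run_eq x r : (forall i, (i < r)%N -> x i = x 0) -> x r != x 0 -> run x = r.
Proof.
move=> h hr; rewrite /run; case: pselect => [e|[]]; last by exists r.
case: ex_minnP => m hm mmin; apply/eqP; rewrite eqn_leq mmin // leqNgt.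
by apply/negP => /h/eqP; rewrite (negbTE hm).
Qed.

Lemma runP x : (run x = 0 /\ forall n, x n = x 0) \/
  [/\ (0 < run x)%N, forall i, (i < run x)%N -> x i = x 0 & x (run x) != x 0].
Proof.
have [[n hn]|h] := pselect (exists n, x n != x 0); last first.
  left; have h' n : x n = x 0 by apply/eqP/negPn/negP => ?; apply: h; exists n.
  by split=> //; exact: run_const.
right; case: (ex_minnP (ex_intro _ n hn : exists n, x n != x 0)) => m hm mmin.
have xi i : (i < m)%N -> x i = x 0.
  by move=> im; apply/eqP/negPn/negP => /mmin; rewrite leqNgt im.
rewrite (@run_eq _ m) //; split=> //.
by case: m hm {mmin xi} => //; rewrite eqxx.
Qed.

(** * Run costs and the mass they give to words *)

Section RunCost.
Variable R : realType.

(* [expR (- log_weight r)] is the probability [1 / (r (r + 1))] of a run of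
   length [r]; [log_weight 0 = 0] because [ln 0 = 0]. *)
Definition log_weight (r : nat) : R := ln ((r * r.+1)%N%:R).

(** The remaining length counts down from [r] to 1 along a run, so these increments telescope to
    [log_weight r]. The value at 0, the code of an infinite run, is 0. *)
Definition run_cost (r : nat) : R := log_weight r - log_weight r.-1.

Lemma log_weight0 : log_weight 0 = 0.
Proof. by rewrite /log_weight mul0n ln0. Qed.

Lemma log_weight1 : log_weight 1 = ln 2.
Proof. by rewrite /log_weight mul1n. Qed.

Lemma log_weight_ge0 r : 0 <= log_weight r.
Proof.
case: r => [|r]; first by rewrite log_weight0.
by rewrite /log_weight ln_ge0// -[1]/(1%:R) ler_nat; lia.
Qed.

Lemma log_weight_lt m n : (m < n)%N -> log_weight m < log_weight n.
Proof.
case: n => // n; case: m => [|m] mn.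
  by rewrite log_weight0 ln_gt0// -[1]/(1%:R) ltr_nat; lia.
rewrite /log_weight ltr_ln ?posrE ?ltr0n ?ltr_nat; try lia.
by apply: ltn_mul; lia.
Qed.

Lemma log_weight_le m n : (m <= n)%N -> log_weight m <= log_weight n.
Proof. by rewrite leq_eqVlt => /predU1P[->//|/log_weight_lt/ltW]. Qed.

Lemma run_cost0 : run_cost 0 = 0. Proof. by rewrite /run_cost subrr. Qed.

Lemma run_cost_gt0 r : (0 < r)%N -> 0 < run_cost r.
Proof. by move=> r0; rewrite subr_gt0 log_weight_lt; lia. Qed.

Lemma run_cost_ge0 r : 0 <= run_cost r.
Proof. by case: r => [|r]; [rewrite run_cost0|apply/ltW/run_cost_gt0]. Qed.

Lemma sum_run_cost r : \sum_(i < r) run_cost i.+1 = log_weight r.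
Proof.
elim: r => [|r IH]; first by rewrite big_ord0 log_weight0.
by rewrite big_ord_recr /= IH /run_cost /= addrC subrK.
Qed.

Lemma expR_run_cost1 : expR (- run_cost 1) = 2^-1 :> R.
Proof. by rewrite /run_cost /= log_weight0 log_weight1 subr0 expRN lnK// posrE. Qed.

Lemma expR_run_costS r : (0 < r)%N ->
  expR (- run_cost r.+1) = r%:R / r.+2%:R :> R.
Proof.
move=> r0; rewrite /run_cost /= opprB expRD expRN /log_weight.
rewrite !lnK ?posrE ?ltr0n ?muln_gt0 ?r0 // !natrM.
have : r.+1%:R != 0 :> R by rewrite pnatr_eq0.
have : r.+2%:R != 0 :> R by rewrite pnatr_eq0.
by move=> *; field; do ?[apply/andP; split].
Qed.

(** The exponential of the left side is [(r + 2) / r = 1 + 2 / r], and [ln (1 + y) <= y]. This decay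
    will make the cost continuous at the two constant sequences. *)
Lemma run_cost_le_inv r : (0 < r)%N -> run_cost r.+1 <= 2 / r%:R.
Proof.
move=> r0.
have r0' : 0 < r%:R :> R by rewrite ltr0n.
have E : expR (run_cost r.+1) = 1 + 2 / r%:R :> R.
  rewrite -[run_cost _]opprK expRN expR_run_costS// invfM invrK.
  rewrite -addn2 natrD; field; exact: lt0r_neq0.
have -> : run_cost r.+1 = ln (1 + 2 / r%:R) by rewrite -E expRK.
apply: le_ln1Dx; have : 0 < 2 / r%:R :> R by rewrite divr_gt0.
by move=> *; lra.
Qed.

(** By telescoping, [expR (- word_cost w)] is the product of [1 / (r (r + 1))] over the lengths [r]
    of the runs of [w], the last run being treated as complete. *)
Fixpoint word_cost (w : seq bool) : R :=
  if w is _ :: w' then run_cost (word_run w) + word_cost w' else 0.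

(* [word_run w + 1] is the tail-to-mass ratio of the run-length distribution;
   it is an eigenvector, for the eigenvalue 1, of the transfer operator of
   [- run_cost]. *)
Lemma sum_words_eigen M :
  \sum_(w <- words M.+1) expR (- word_cost w) * (word_run w).+1%:R = 2 :> R.
Proof.
elim: M => [|M IH].
  rewrite /= !big_cons big_nil /= addr0 expR_run_cost1; lra.
rewrite -[RHS]IH [words M.+2]/= big_cat !big_map /= -big_split.
(* Of the two letters that can be put in front of [d :: w], one lengthens its initial run and the
   other starts a run of length 1. *)
have step d w : expR (- (run_cost (word_run [:: true, d & w]) + word_cost (d :: w)))
    * (word_run [:: true, d & w]).+1%:R +
  expR (- (run_cost (word_run [:: false, d & w]) + word_cost (d :: w)))
    * (word_run [:: false, d & w]).+1%:R =
  expR (- word_cost (d :: w)) * (word_run (d :: w)).+1%:R.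
  have r0 : (0 < word_run (d :: w))%N by rewrite /=; case: ifP.
  (* With [r] the initial run, this is [r / (r + 2) * (r + 2) + 1 / 2 * 2 = r + 1]. *)
  suff : expR (- run_cost (word_run (d :: w)).+1) * (word_run (d :: w)).+2%:R +
    expR (- run_cost 1) * 2 = (word_run (d :: w)).+1%:R :> R.
    have runE c : word_run [:: c, d & w] =
      if d == c then (word_run (d :: w)).+1 else 1 by [].
    move=> E; rewrite -E !runE; move: (word_run _) (word_cost _) => r C.
    have h a c e f : expR (- (a + C)) * e + expR (- (c + C)) * f =
        expR (- C) * (expR (- a) * e + expR (- c) * f) :> R.
      by rewrite !opprD !expRD; ring.
    by case: d {E r0 runE} => /=; rewrite h// addrC.
  rewrite expR_run_costS // expR_run_cost1 divfK ?pnatr_eq0 //.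
  by rewrite mulVf ?pnatr_eq0 // natr1.
rewrite !big_cat !big_map.
by congr (_ + _); apply: eq_bigr => w _; rewrite -step.
Qed.

(** On nonempty words the eigenvector is at least 2, while its weighted sum equals 2. *)
Lemma sum_words_le1 M : \sum_(w <- words M) expR (- word_cost w) <= 1 :> R.
Proof.
case: M => [|M]; first by rewrite big_seq1 oppr0 expR0.
have := sum_words_eigen M => E.
suff : (\sum_(w <- words M.+1) expR (- word_cost w)) * 2 <= 2 :> R by lra.
rewrite -{}[leRHS]E mulr_suml.
rewrite -[words M.+1]/([seq true :: w | w <- words M] ++
  [seq false :: w | w <- words M]) !big_cat !big_map.
apply: lerD; apply: ler_sum => w _; apply: ler_wpM2l; rewrite ?expR_ge0//;
  by rewrite ler_nat /=; case: ifP.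
Qed.

Lemma word_cost_prefixS M (x : nat -> bool) :
  word_cost (prefix_word M.+1 x) =
  run_cost (word_run (prefix_word M.+1 x)) +
  word_cost (prefix_word M (fun n => x n.+1)).
Proof. by []. Qed.

Lemma word_cost_const M (x : nat -> bool) :
  (forall i, (i < M)%N -> x i = x 0) ->
  word_cost (prefix_word M x) = log_weight M.
Proof.
elim: M x => [|M IH] x h; first by rewrite log_weight0.
rewrite word_cost_prefixS (@word_run_prefix _ M.+1) ?leqnn//; last by left.
rewrite IH => [|i iM]; first by rewrite /run_cost /= subrK.
have M0 : (0 < M)%N by apply: leq_ltn_trans iM.
by rewrite h// (h 1%N).
Qed.

(** A run ending inside the word is charged its true cost. Only the final run may be truncated, and
    all its letters together cost at most [log_weight M]. *)
Lemma word_cost_le M (x : nat -> bool) :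
  word_cost (prefix_word M x) <=
  \sum_(i < M) run_cost (run (fun n => x (i + n)%N)) + log_weight M.
Proof.
elim: M x => [|M IH] x; first by rewrite big_ord0 log_weight0 addr0.
have S0 : 0 <= \sum_(i < M.+1) run_cost (run (fun n => x (i + n)%N)).
  by apply: sumr_ge0 => i _; exact: run_cost_ge0.
have [h|h] := pselect (forall i, (i < M.+1)%N -> x i = x 0).
  by rewrite word_cost_const// lerDr.
have [[_ xc]|[r0 xr xr']] := runP x; first by exfalso; apply: h.
have rM : (run x <= M)%N.
  rewrite leqNgt; apply/negP => rM; apply: h => i iM.
  by apply: xr; apply: leq_trans iM rM.
rewrite word_cost_prefixS (@word_run_prefix _ (run x))//;
  [|by rewrite r0 ltnW|by right].
rewrite big_ord_recl -[leRHS]addrA; apply: lerD => //.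
by apply: (le_trans (IH _)); apply: lerD => //; exact: log_weight_le.
Qed.

End RunCost.

(** * The shift on the Cantor space *)

Definition agree (N : nat) (x y : nat -> bool) : Prop :=
  forall i, (i < N)%N -> y i = x i.

Lemma agreeW N M x y : (N <= M)%N -> agree M x y -> agree N x y.
Proof. by move=> NM h i iN; apply: h; apply: leq_trans NM. Qed.

Lemma agree_sym N x y : agree N x y -> agree N y x.
Proof. by move=> h i /h. Qed.

Lemma nbhs_agree N (x : cantor_space) : \forall y \near x, agree N x y.
Proof.
have ev i : \forall y \near x, y i = x i.
  have := (pointwise_cvgP (F := nbhs x) (x : nat -> bool)
    (nbhs_filter x)).1 (fun (A : set cantor_space) (xA : nbhs x A) => xA) i.
  by move=> /(_ [set x i]); apply; exact: discrete_set1.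
elim: N => [|N IH]; first by near=> y => i.
have E := ev N.
near=> y => i; rewrite ltnS leq_eqVlt => /predU1P[->|iN].
  by near: y.
by move: i iN; rewrite -/(agree N x y); near: y.
Unshelve. all: by end_near.
Qed.

(** Otherwise, for each [N] some point outside [U] agrees with [x] up to [N]; these points converge
    to [x] pointwise, hence in the product topology. *)
Lemma nbhs_agreeP (x : cantor_space) (U : set cantor_space) :
  nbhs x U -> exists N, forall y, agree N x y -> U y.
Proof.
move=> xU; apply: contrapT => h; pose P N y := agree N x y /\ ~ U y.
have {}h N : exists y, P N y.
  have /existsNP[y /not_implyP hy] : ~ (forall y, agree N x y -> U y).
    by move=> hN; apply: h; exists N.
  by exists y.
have [u hu] := choice h.
suff : u @ \oo --> x.
  move=> /(_ _ xU)[N _ /(_ N (leqnn N))]; exact: (hu N).2.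
suff : {ptws, u @ \oo --> (x : nat -> bool)} by [].
apply/pointwise_cvgP => i A /nbhs_singleton Axi.
by exists i.+1 => // n /= ni; rewrite (hu n).1.
Qed.

Definition cylinder_set (N : nat) (A : set (nat -> bool)) : Prop :=
  forall x y, agree N x y -> A x -> A y.

Lemma cylinder_open N (A : set cantor_space) : cylinder_set N A -> open A.
Proof.
move=> cA; rewrite openE => x Ax /=; near=> y.
by apply: cA Ax; near: y; exact: nbhs_agree.
Unshelve. all: by end_near.
Qed.

Lemma cylinder_measurable N (A : set borel_cantor) :
  cylinder_set N A -> measurable A.
Proof. by move=> cA; apply: sub_sigma_algebra; exact: cylinder_open cA. Qed.

Lemma agree_full_shift N (x y : borel_cantor) :
  agree N.+1 x y -> agree N (full_shift x) (full_shift y).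
Proof. by move=> h i iN; exact: h. Qed.

Lemma iter_full_shift i (x : borel_cantor) n : iter i full_shift x n = x (i + n)%N.
Proof.
elim: i n => //= i IH n.
by rewrite -[full_shift _ n]/(iter i full_shift x n.+1) IH addnS.
Qed.

Lemma measurable_cantor_open (g : borel_cantor -> borel_cantor) :
  (forall U : set cantor_space, open U -> open ((g @^-1` U) : set cantor_space)) ->
  measurable_fun setT g.
Proof.
move=> cg; apply: (@measurability _ _ _ borel_cantor setT g (@open cantor_space)) => //.
by move=> _ [U oU <-]; rewrite setTI; apply: sub_sigma_algebra; exact: cg.
Qed.

Lemma measurable_full_shift : measurable_fun setT full_shift.
Proof.
apply: measurable_cantor_open => U oU; rewrite openE => x Ux /=.
have [N hN] := nbhs_agreeP _ _ (open_nbhs_nbhs (conj oU Ux)).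
near=> y; apply: hN; apply: agree_full_shift; near: y; exact: nbhs_agree.
Unshelve. all: by end_near.
Qed.

Lemma measurable_iter_full_shift i : measurable_fun setT (iter i full_shift).
Proof.
elim: i => [|i IH]; first exact: measurable_id.
by rewrite [X in measurable_fun _ X](_ : _ = full_shift \o iter i full_shift)//;
  apply: measurableT_comp => //; exact: measurable_full_shift.
Qed.

(** * Invariant integrals and approximation by cylinder sets *)

Section Measures.
Variable R : realType.

Lemma continuous_agreeP (g : cantor_space -> R) :
  (forall x e, 0 < e -> exists N, forall y, agree N x y -> `|g x - g y| < e) ->
  continuous g.
Proof.
move=> h x; apply/cvgrPdist_lt => e e0; have [N hN] := h x e e0.
near=> y; apply: hN; near: y; exact: nbhs_agree.
Unshelve. all: by end_near.
Qed.

Lemma measurable_cantor_continuous (g : cantor_space -> R) :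
  continuous g -> measurable_fun [set: borel_cantor] g.
Proof.
move=> cg; apply: (measurability _ (RGenOpens.measurableE R)).
move=> _ [_ [a [b ->]] <-]; rewrite setTI; apply: sub_sigma_algebra.
move/continuousP: cg; apply; exact: interval_open.
Qed.

Lemma invariant_iter (nu : probability borel_cantor R) (i : nat) (A : set borel_cantor) :
  invariant_measure full_shift nu -> measurable A ->
  nu (iter i full_shift @^-1` A) = nu A.
Proof.
move=> inu; elim: i A => // i IH A mA.
have mA' : measurable (full_shift @^-1` A).
  by rewrite -[X in measurable X]setTI; exact: measurable_full_shift.
by rewrite -(inu _ mA) -(IH _ mA').
Qed.

Lemma ge0_integral_iter (nu : probability borel_cantor R) (i : nat)
    (g : borel_cantor -> \bar R) :
  invariant_measure full_shift nu -> measurable_fun setT g ->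
  (forall x, 0 <= g x)%E ->
  (\int[nu]_x g (iter i full_shift x) = \int[nu]_x g x)%E.
Proof.
move=> inu mg g0.
transitivity (\int[pushforward nu (iter i full_shift)]_x g x)%E.
  rewrite ge0_integral_pushforward ?preimage_setT//.
  exact: measurable_iter_full_shift.
apply: eq_measure_integral => [|? A mA _]; last exact: (@invariant_iter nu i A inu mA).
by move=> ? A mA; exact: measurable_iter_full_shift.
Qed.


Definition approximable (nu : probability borel_cantor R) (A : set borel_cantor) :=
  measurable A /\ forall e : R, 0 < e -> exists N C,
    cylinder_set N C /\ (nu ((A `\` C) `|` (C `\` A)) < e%:E)%E.

Lemma approximableC nu A : approximable nu A -> approximable nu (~` A).
Proof.
move=> [mA h]; split=> [|e e0]; first exact: measurableC.
have [N [C [cC lt]]] := h e e0; exists N, (~` C); split.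
  by move=> x y xy nCx Cy; apply: nCx; apply: cC Cy; exact: agree_sym.
by rewrite !setDE !setCK setUC [_ `&` A]setIC [_ `&` C]setIC -!setDE.
Qed.

Lemma approximableU nu A B : approximable nu A -> approximable nu B ->
  approximable nu (A `|` B).
Proof.
move=> [mA hA] [mB hB]; split=> [|e e0]; first exact: measurableU.
have e20 : 0 < e / 2 by lra.
have [N [C [cC ltC]]] := hA _ e20; have [M [D [cD ltD]]] := hB _ e20.
exists (maxn N M), (C `|` D); split.
  move=> x y xy [Cx|Dx].
    by left; apply: cC Cx; apply: agreeW xy; exact: leq_maxl.
  by right; apply: cD Dx; apply: agreeW xy; exact: leq_maxr.
have mC := cylinder_measurable _ _ cC; have mD := cylinder_measurable _ _ cD.
apply: (@le_lt_trans _ _ (nu (((A `\` C) `|` (C `\` A)) `|`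
  ((B `\` D) `|` (D `\` B))))).
  apply: le_measure; rewrite ?inE;
    do ?[apply: measurableU | apply: measurableD]; rewrite //.
  move=> x [[[Ax|Bx] nCD]|[[Cx|Dx] nAB]].
  - by left; left; split=> // Cx; apply: nCD; left.
  - by right; left; split=> // Dx; apply: nCD; right.
  - by left; right; split=> // Ax; apply: nAB; left.
  - by right; right; split=> // Bx; apply: nAB; right.
apply: (le_lt_trans (measureU2 _ _ _));
  do ?[apply: measurableU | apply: measurableD]; rewrite //.
by rewrite [e]splitr EFinD lteD.
Qed.

(** By continuity from below, some [F n] misses less than [e / 2] of the union; a cylinder set
    within [e / 2] of that [F n] is then within [e] of the union. *)
Lemma approximable_limit nu (F : nat -> set borel_cantor) :
  nondecreasing_seq F -> (forall n, approximable nu (F n)) ->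
  approximable nu (\bigcup_n F n).
Proof.
move=> ndF aF; have mF n : measurable (F n) := (aF n).1.
have mU : measurable (\bigcup_n F n) by exact: bigcupT_measurable.
split=> // e e0; have e20 : 0 < e / 2 by lra.
have fin A : measurable A -> (nu A \is a fin_num)%E by exact: fin_num_measure.
have : nu \o F @ \oo --> (fine (nu (\bigcup_n F n)))%:E.
  by rewrite fineK ?fin//; exact: nondecreasing_cvg_mu.
move=> /fine_cvgP[_ /cvgrPdist_lt/(_ _ e20)[n _ /(_ n (leqnn n)) /= hn]].
have [N [C [cC ltC]]] := (aF n).2 _ e20; exists N, C; split=> //.
have mC := cylinder_measurable _ _ cC.
apply: (@le_lt_trans _ _ (nu ((\bigcup_n F n `\` F n) `|`
    ((F n `\` C) `|` (C `\` F n))))).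
  apply: le_measure; rewrite ?inE;
    do ?[apply: measurableU | apply: measurableD]; rewrite //.
  move=> x [[Ux nCx]|[Cx nUx]].
    by have [Fx|nFx] := pselect (F n x); [right; left|left].
  by right; right; split=> // Fx; apply: nUx; exists n.
apply: (le_lt_trans (measureU2 _ _ _));
  do ?[apply: measurableU | apply: measurableD]; rewrite //.
rewrite [e]splitr EFinD lteD//.
have sub : F n `<=` \bigcup_n F n by move=> x Fx; exists n.
rewrite measureD// ?ltey_eq ?fin// setIC (setIidl sub).
have E : (nu (\bigcup_n F n) - nu (F n))%E =
    (fine (nu (\bigcup_n F n)) - fine (nu (F n)))%:E.
  by rewrite EFinB !fineK ?fin.
have : fine (nu (\bigcup_n F n)) - fine (nu (F n)) < e / 2.
  exact: le_lt_trans (ler_norm _) hn.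
by rewrite -lte_fin -E.
Qed.

(** The approximable sets form a sigma-algebra. It contains each open [U], the increasing union over
    [N] of the largest cylinder sets of depth [N] inside [U]. *)
Lemma measurable_approximable nu A : measurable A -> approximable nu A.
Proof.
have a0 : approximable nu set0.
  split=> // e e0; exists 0, set0; split=> //.
  by rewrite setDv setU0 measure0 lte_fin.
apply: smallest_sub => [|U oU].
  split=> // [B aB|F aF]; first by rewrite setTD; exact: approximableC.
  rewrite -bigcup_bigsetU_bigcup; apply: approximable_limit.
    by move=> n m nm; apply/subsetPset; exact: subset_bigsetU.
  move=> n; elim: n.+1 => [|m IH]; first by rewrite big_ord0.
  by rewrite big_ord_recr; apply: approximableU.
pose F N := [set x | forall y, agree N x y -> U y].
have cF N : cylinder_set N (F N).
  move=> x y xy Fx z yz; apply: Fx => i iN; rewrite yz//; exact: xy.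
rewrite (_ : U = \bigcup_N F N).
  apply: approximable_limit => [n m nm|n].
    by apply/subsetPset => x Fx y xy; apply: Fx; exact: agreeW xy.
  split=> [|e e0]; first exact: cylinder_measurable (cF n).
  by exists n, (F n); split=> //; rewrite setDv setU0 measure0 lte_fin.
apply/seteqP; split=> [x Ux|x [N _]]; last by apply.
have [N hN] := nbhs_agreeP _ _ (open_nbhs_nbhs (conj oU Ux)).
by exists N.
Qed.

End Measures.

Lemma run_agree (x y : nat -> bool) : (0 < run x)%N -> agree (run x).+1 x y ->
  run y = run x.
Proof.
move=> r0 xy; have [[r]|[_ xr xr']] := runP x; first by rewrite r in r0.
have y0 : y 0 = x 0 by exact: xy.
apply: run_eq => [i ir|]; rewrite y0 xy//.
  exact: xr.
exact: ltnW.
Qed.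

(** Near a constant sequence the run is infinite or long. A function of [run] is therefore
    continuous there once its values at long runs tend to its value at 0. *)
Lemma run_agree_const N (x y : nat -> bool) :
  run x = 0%N -> agree N.+1 x y -> run y = 0%N \/ (N < run y)%N.
Proof.
move=> x0 xy; have [[_ xc]|[r0 _ _]] := runP x; last by rewrite x0 in r0.
have [[]|[r0 yr yr']] := runP y; [by left|right].
rewrite ltnNge; apply/negP => rN; case/eqP: yr'.
by rewrite (xy 0)// (xy (run y))// !xc.
Qed.

(** * The cost potential, Gibbs' inequality and cylinder codes of partitions *)

Section Potential.
Variable R : realType.

Definition escape_cost (x : cantor_space) : R := run_cost R (run x).

Lemma run_cost_le2 r : run_cost R r <= 2.
Proof.
case: r => [|[|r]]; first by rewrite run_cost0.
  rewrite /run_cost log_weight1 log_weight0 subr0.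
  have := @le_ln1Dx R 1; rewrite (_ : 1 + 1 = 2 :> R)// => H.
  by have := H ltac:(lra); lra.
apply: le_trans (run_cost_le_inv _ _ _) _ => //.
by rewrite ler_pdivrMr ?ltr0n// ler_peMr// ler1n.
Qed.

Lemma run_cost_cvg0 e : 0 < e -> exists N, forall r, (N < r)%N -> run_cost R r < e.
Proof.
move=> e0; have := archi_boundP (ltW (divr_gt0 (ltr0n R 2) e0)).
set N := Num.bound _ => hN; exists N.+1 => -[//|r] /= Nr.
have r0 : (0 < r)%N by lia.
apply: le_lt_trans (run_cost_le_inv _ _ r0) _.
rewrite ltr_pdivrMr ?ltr0n// mulrC -ltr_pdivrMr//.
by apply: lt_le_trans hN _; rewrite ler_nat; lia.
Qed.

Lemma escape_cost_ge0 x : 0 <= escape_cost x.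
Proof. exact: run_cost_ge0. Qed.

Lemma escape_cost_continuous : continuous escape_cost.
Proof.
apply: continuous_agreeP => x e e0.
have [x0|] := eqVneq (run x) 0%N; last first.
  rewrite -lt0n => r0; exists (run x).+1 => y xy.
  by rewrite /escape_cost (run_agree _ y r0)// subrr normr0.
have [N hN] := run_cost_cvg0 _ e0; exists N.+1 => y xy.
rewrite /escape_cost x0 run_cost0 sub0r normrN ger0_norm ?run_cost_ge0//.
have [->|] := run_agree_const _ _ _ x0 xy; first by rewrite run_cost0.
exact: hN.
Qed.

Lemma measurable_escape_cost : measurable_fun [set: borel_cantor] escape_cost.
Proof. exact: measurable_cantor_continuous escape_cost_continuous. Qed.

(** Termwise this is [ln y <= y - 1] at [y = q s / p s]. Terms with [p s = 0] vanish on both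
    sides. *)
Lemma gibbs_inequality (S : finType) (p q : S -> R) :
  (forall s, 0 <= p s) -> (forall s, 0 < q s) ->
  \sum_s q s <= \sum_s p s ->
  \sum_s - (p s * ln (p s)) <= \sum_s p s * - ln (q s).
Proof.
move=> p0 q0 qp.
suff : \sum_s (- (p s * ln (p s)) - p s * - ln (q s)) <= \sum_s (q s - p s).
  rewrite !big_split/= !sumrN => H.
  have : \sum_s q s - \sum_s p s <= 0 by lra.
  by lra.
apply: ler_sum => s _.
have [->|ps0] := eqVneq (p s) 0.
  by have := q0 s; rewrite !mul0r oppr0 !addr0 => /ltW.
have {ps0} ps0 : 0 < p s by rewrite lt_neqAle eq_sym ps0 p0.
have r0 : 0 < q s / p s by rewrite divr_gt0.
have : ln (q s / p s) <= q s / p s - 1.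
  by have := @le_ln1Dx R (q s / p s - 1); rewrite [1 + _]addrC subrK; apply; lra.
rewrite ln_div ?posrE// => H.
have : p s * (ln (q s) - ln (p s)) <= p s * (q s / p s - 1) by rewrite ler_pM2l.
rewrite [leRHS](_ : _ = q s - p s); first by lra.
by field; exact: lt0r_neq0.
Qed.

(** Each block is approximated by a cylinder set within [d / k], and [E] is the union of the
    symmetric differences. The code [p] picks any cylinder set containing the point; off [E] one
    exists and its block contains the point. *)
Lemma cylinder_approx_partition (nu : probability borel_cantor R) (k : nat)
    (A : 'I_k -> set borel_cantor) (d : R) :
  measurable_partition A -> 0 < d ->
  exists N (p : (nat -> bool) -> 'I_k) (E : set borel_cantor),
    [/\ forall x y, agree N x y -> p x = p y, measurable E,
        (nu E <= d%:E)%E & forall x, ~ E x -> A (p x) x].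
Proof.
move=> [mA tA cA] d0.
(* The space is nonempty, so there is a block: this gives [0 < k] and a default index for the
   code. *)
have [i0 _ _] : (\bigcup_i A i) (fun=> false) by rewrite cA.
have k0 : 0 < k%:R :> R by rewrite ltr0n; apply: leq_ltn_trans (ltn_ord i0).
have h i : exists NC : nat * set borel_cantor, cylinder_set NC.1 NC.2 /\
    (nu ((A i `\` NC.2) `|` (NC.2 `\` A i)) < (d / k%:R)%:E)%E.
  have [N [C hC]] := (measurable_approximable R nu _ (mA i)).2 (d / k%:R)
    (divr_gt0 d0 k0).
  by exists (N, C).
have [NC hNC] := choice h; pose C i := (NC i).2.
have mC i : measurable (C i) by exact: cylinder_measurable (hNC i).1.
pose B i := (A i `\` C i) `|` (C i `\` A i).
have mB i : measurable (B i).
  by apply: measurableU; apply: measurableD.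
exists (\max_i (NC i).1)%N,
  (fun x => odflt i0 [pick i | `[< C i x >]]), (\big[setU/set0]_i B i).
split.
- move=> x y xy; congr odflt; apply: eq_pick => i /=.
  have xyi : agree (NC i).1 x y by apply: agreeW xy; exact: leq_bigmax.
  apply/asboolP/asboolP => h'; apply: (hNC i).1 h' => //; exact: agree_sym.
- exact: bigsetU_measurable.
- apply: (@le_trans _ _ (\sum_(i < k) (d / k%:R)%:E)%E); last first.
    rewrite sumEFin lee_fin sumr_const card_ord -[leLHS]mulr_natr.
    by rewrite divfK ?gt_eqF.
  suff [_ H] : measurable (\big[setU/set0]_i B i) /\
      (nu (\big[setU/set0]_i B i) <= \sum_(i < k) (d / k%:R)%:E)%E by [].
  apply: (big_ind2 (fun S y => measurable S /\ (nu S <= y)%E)) => [|S y T z|i _].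
  + by rewrite measure0.
  + move=> [mS leS] [mT leT]; split; first exact: measurableU.
    by apply: (le_trans (measureU2 _ mS mT)); exact: leeD.
  + by split=> //; exact/ltW/(hNC i).2.
move=> x nE; have {}nE i : ~ B i x.
  by move=> Bi; apply: nE; rewrite (bigD1 i)//=; left.
case: pickP => [i /asboolP Ci|nC] /=.
  by apply: contrapT => nA; apply: (nE i); right.
have [i _ Ai] : (\bigcup_i A i) x by rewrite cA.
exfalso; apply: (nE i); left; split=> // Ci.
by have := nC i; rewrite (asboolT Ci).
Qed.

End Potential.

(** * The entropy bound *)

Section Coding.
Variables (R : realType) (k N : nat) (p : (nat -> bool) -> 'I_k) (eta : R).
Hypotheses (cyl : forall x y, agree N x y -> p x = p y)
  (eta0 : 0 < eta) (eta1 : eta < 1).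

(** The index is kept with probability [1 - eta] and otherwise redrawn uniformly. The noise bounds
    the logarithms of all entries. *)
Definition noisy_kernel (i j : 'I_k) : R := (1 - eta) * (i == j)%:R + eta / k%:R.

Lemma ord_bound_gt0 (i : 'I_k) : 0 < k%:R :> R.
Proof. by rewrite ltr0n; apply: leq_ltn_trans (ltn_ord i). Qed.

Lemma noisy_kernel_ge i j : eta / k%:R <= noisy_kernel i j.
Proof. by rewrite lerDr mulr_ge0 ?ler0n// subr_ge0 ltW. Qed.

Lemma noisy_kernel_gt0 i j : 0 < noisy_kernel i j.
Proof.
by apply: lt_le_trans (noisy_kernel_ge i j); rewrite divr_gt0 ?(ord_bound_gt0 i).
Qed.

Lemma noisy_kernel_diag i : 1 - eta <= noisy_kernel i i.
Proof. by rewrite /noisy_kernel eqxx mulr1 lerDl divr_ge0// ltW. Qed.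

Lemma sum_noisy_kernel i : \sum_j noisy_kernel i j = 1.
Proof.
rewrite big_split/= sumr_const card_ord -[X in _ + X]mulr_natr.
rewrite divfK ?gt_eqF ?(ord_bound_gt0 i)//.
rewrite (bigD1 i)//= eqxx mulr1 big1 ?addr0 => [|j]; first by ring.
by rewrite eq_sym => /negbTE ->; rewrite mulr0.
Qed.

(* Draw a word with the run-length weights and read its [p]-code through the noisy
   kernel: Gibbs' inequality against this subprobability on itineraries replaces
   the Kolmogorov-Sinai generator theorem. *)
Definition code_prob (n : nat) (s : {ffun 'I_n -> 'I_k}) : R :=
  \sum_(w <- words (n + N)) expR (- word_cost R w) *
    \prod_(i < n) noisy_kernel (p (fun m => nth false w (i + m))) (s i).

Lemma sum_code_prob n : \sum_s code_prob n s <= 1.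
Proof.
rewrite exchange_big/=; apply: le_trans (sum_words_le1 R (n + N)).
rewrite le_eqVlt; apply/orP; left; apply/eqP.
apply: eq_bigr => w _; rewrite -mulr_sumr.
rewrite -(bigA_distr_bigA (fun (i : 'I_n) j =>
  noisy_kernel (p (fun m => nth false w (i + m))) j)).
by rewrite big1 ?mulr1// => i _; exact: sum_noisy_kernel.
Qed.

(** Only the term of the prefix of [x] is kept. Its [n + N] letters determine the codes of the first
    [n] shifts, each of which reads [N] letters. *)
Lemma code_prob_ge n (s : {ffun 'I_n -> 'I_k}) (x : borel_cantor) :
  expR (- word_cost R (prefix_word (n + N) x)) *
    \prod_(i < n) noisy_kernel (p (iter i full_shift x)) (s i) <= code_prob n s.
Proof.
rewrite /code_prob (big_rem _ (prefix_word_in (n + N) x))/=.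
rewrite [X in _ <= X + _](_ : _ = expR (- word_cost R (prefix_word (n + N) x)) *
    \prod_(i < n) noisy_kernel (p (iter i full_shift x)) (s i)).
  rewrite lerDl sumr_ge0// => w _; rewrite mulr_ge0 ?expR_ge0// prodr_ge0// => i _.
  exact/ltW/noisy_kernel_gt0.
congr (_ * _); apply: eq_bigr => i _; congr noisy_kernel; apply: cyl => m mN.
rewrite iter_full_shift nth_prefix_word//.
by have := ltn_ord i; lia.
Qed.

Lemma code_prob_gt0 n (s : {ffun 'I_n -> 'I_k}) : 0 < code_prob n s.
Proof.
apply: lt_le_trans (code_prob_ge n s (fun=> false)).
by rewrite mulr_gt0 ?expR_gt0// prodr_gt0// => i _; exact: noisy_kernel_gt0.
Qed.

Lemma ln_code_prob_le n (s : {ffun 'I_n -> 'I_k}) (x : borel_cantor) :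
  - ln (code_prob n s) <= word_cost R (prefix_word (n + N) x) +
    \sum_(i < n) - ln (noisy_kernel (p (iter i full_shift x)) (s i)).
Proof.
rewrite lerNl opprD sumrN opprK.
have [P0 lnP] : 0 < \prod_(i < n) noisy_kernel (p (iter i full_shift x)) (s i) /\
    ln (\prod_(i < n) noisy_kernel (p (iter i full_shift x)) (s i)) =
    \sum_(i < n) ln (noisy_kernel (p (iter i full_shift x)) (s i)).
  elim/big_rec2: _ => [|i y z _ [y0 <-]]; first by rewrite ln1.
  have K0 := noisy_kernel_gt0 (p (iter i full_shift x)) (s i).
  by rewrite mulr_gt0// lnM ?posrE.
rewrite -lnP -[X in X + _]expRK -lnM ?posrE ?expR_gt0//.
by rewrite ler_ln ?posrE ?mulr_gt0 ?expR_gt0 ?code_prob_gt0// code_prob_ge.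
Qed.

End Coding.

Section EntropyBound.
Variables (R : realType) (nu : probability borel_cantor R).
Hypothesis inu : invariant_measure full_shift nu.

Lemma measurable_join_block k (A : 'I_k -> set borel_cantor) n
    (s : {ffun 'I_n -> 'I_k}) :
  (forall i, measurable (A i)) -> measurable (join_block full_shift A s).
Proof.
move=> mA; rewrite (_ : join_block _ _ _ =
    \bigcap_(i in [set: 'I_n]) (iter i full_shift @^-1` A (s i))).
  apply: fin_bigcap_measurable => // i _.
  by rewrite -[X in measurable X]setTI; exact: measurable_iter_full_shift.
by apply/seteqP; split => [x h i _|x h i]; exact: h.
Qed.

Lemma integrable_bounded (g : borel_cantor -> R) K :
  measurable_fun setT g -> (forall x, `|g x| <= K) ->
  nu.-integrable setT (EFin \o g).
Proof.
move=> mg gK; apply: measurable_bounded_integrable => //.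
  by rewrite -ge0_fin_numE ?measure_ge0//; exact: fin_num_measure.
exists K; split; first exact: num_real.
by move=> M KM x _; apply: le_trans (gK x) (ltW KM).
Qed.

Lemma integral_join_block k (A : 'I_k -> set borel_cantor) n (U : borel_cantor -> \bar R) :
  measurable_partition A -> measurable_fun setT U -> (forall x, 0 <= U x)%E ->
  (\sum_(s : {ffun 'I_n -> 'I_k}) \int[nu]_(x in join_block full_shift A s) U x =
   \int[nu]_x U x)%E.
Proof.
move=> [mA tA cA] mU U0.
rewrite -ge0_integral_bigsetU ?index_enum_uniq//; first last.
- exact: measurable_funTS.
- move=> s t _ _ [x [Bs Bt]]; apply/ffunP => i.
  by apply: (tA _ _ I I); exists (iter i full_shift x).
- by move=> s; exact: measurable_join_block.
congr (integral _ _ _); apply/seteqP; split=> // x _.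
have h y : exists i, A i y.
  by have [i _ Ai] : (\bigcup_i A i) y; [rewrite cA|exists i].
have [a ha] := choice h.
rewrite (bigD1 [ffun i : 'I_n => a (iter i full_shift x)])//=.
by left => i; rewrite ffunE.
Qed.

Lemma sum_join_block k (A : 'I_k -> set borel_cantor) n :
  measurable_partition A ->
  \sum_(s : {ffun 'I_n -> 'I_k}) fine (nu (join_block full_shift A s)) = 1.
Proof.
move=> PA; have [mA _ _] := PA; apply: EFin_inj; rewrite -sumEFin.
have := integral_join_block k A n (cst 1%E) PA (measurable_cst _) (fun=> lee01).
rewrite integral_cst// mul1e [X in _ = X -> _](_ : _ = 1%E); last exact: probability_setT.
move=> <-; apply: eq_bigr => s _.
have mB := measurable_join_block _ A n s mA.
by rewrite integral_cst// mul1e fineK ?fin_num_measure.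
Qed.

(** The pointwise bound is integrated over each block; the blocks partition the space, and by
    invariance each of the [n] shifted copies of [G] has the same integral. *)
Lemma sum_join_block_le k (A : 'I_k -> set borel_cantor) n (v : {ffun 'I_n -> 'I_k} -> R)
    (G : borel_cantor -> R) (K C : R) :
  measurable_partition A -> measurable_fun setT G -> (forall x, 0 <= G x <= K) ->
  0 <= C -> (forall s, 0 <= v s) ->
  (forall s x, join_block full_shift A s x ->
     v s <= \sum_(i < n) G (iter i full_shift x) + C) ->
  \sum_s fine (nu (join_block full_shift A s)) * v s <= n%:R * \int[nu]_x G x + C.
Proof.
move=> [mA tA cA] mG GK C0 v0 vle.
have mB s := measurable_join_block _ A n s mA.
have G0 x : (0 <= (G x)%:E)%E by rewrite lee_fin; case/andP: (GK x).
have mGi i : measurable_fun setT (fun x => (G (iter i full_shift x))%:E).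
  apply/measurable_EFinP; apply: (measurableT_comp mG).
  exact: measurable_iter_full_shift.
pose U x : \bar R := (\sum_(i < n) (G (iter i full_shift x))%:E + C%:E)%E.
have U0 x : (0 <= U x)%E.
  by rewrite adde_ge0 ?lee_fin//; apply: sume_ge0 => i _; exact: G0.
have mU : measurable_fun setT U.
  apply: emeasurable_funD => //.
  exact: emeasurable_sum.
have IG : (\int[nu]_x (G x)%:E)%E = (\int[nu]_x G x)%:E.
  rewrite fineK//; apply: integrable_fin_num => //.
  by apply: (integrable_bounded _ K) => // x; rewrite ger0_norm; case/andP: (GK x).
have IU : (\int[nu]_x U x)%E = (n%:R * \int[nu]_x G x + C)%:E.
  rewrite ge0_integralD//; first last.
  - exact: emeasurable_sum.
  - by move=> x _; apply: sume_ge0 => i _; exact: G0.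
  rewrite integral_cst// [X in (C%:E * X)%E](_ : _ = 1%E); last exact: probability_setT.
  rewrite mule1 EFinD; congr (_ + _)%E.
  rewrite ge0_integral_sum//.
  rewrite (eq_bigr (fun=> (\int[nu]_x (G x)%:E)%E)); last first.
    move=> i _; apply: (ge0_integral_iter R nu i (EFin \o G)) => //.
    exact/measurable_EFinP.
  rewrite IG sumEFin sumr_const card_ord mulr_natl//.
rewrite -lee_fin -IU -sumEFin.
apply: (@le_trans _ _ (\sum_s \int[nu]_(x in join_block full_shift A s) U x)%E).
  apply: lee_sum => s _; rewrite mulrC EFinM fineK ?fin_num_measure//.
  rewrite -integral_cst//; apply: ge0_le_integral => //.
  - by move=> x _; rewrite lee_fin.
  - exact: measurable_funTS.
  - by move=> x Bx; rewrite /U sumEFin -EFinD lee_fin; exact: vle.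
by rewrite integral_join_block.
Qed.

Definition escape_rate : R := \int[nu]_x escape_cost R x.

Lemma log_weight_sublinear (e : R) : 0 < e ->
  exists K, 0 <= K /\ forall M, log_weight R M <= e * M%:R + K.
Proof.
move=> e0; pose d := e / 2; have d0 : 0 < d by rewrite divr_gt0.
(* The constant comes from [log_weight M <= 2 ln (M + 1)] and [ln y <= y - 1] at [y = d (M + 1)]. *)
exists (`|2 * (d - 1 - ln d)|); split=> // M.
apply: le_trans (_ : e * M%:R + 2 * (d - 1 - ln d) <= _); last first.
  by rewrite lerD2l ler_norm.
have lnM1 : ln M.+1%:R <= d * M.+1%:R - 1 - ln d.
  have : ln (d * M.+1%:R) <= d * M.+1%:R - 1.
    have := @le_ln1Dx R (d * M.+1%:R - 1); rewrite [1 + _]addrC subrK; apply.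
    have : 0 < d * M.+1%:R by rewrite mulr_gt0.
    by move=> *; lra.
  by rewrite lnM ?posrE//; lra.
have -> : e * M%:R + 2 * (d - 1 - ln d) = 2 * (d * M.+1%:R - 1 - ln d).
  by rewrite -natr1 /d; field.
apply: (@le_trans _ _ (2 * ln M.+1%:R)); last by rewrite ler_pM2l.
case: M lnM1 => [|M] lnM1; first by rewrite log_weight0 ln1 mulr0.
rewrite /log_weight natrM lnM ?posrE// mulr_natl mulr2n lerD2r.
by rewrite ler_ln ?posrE// ler_nat.
Qed.

(** Gibbs' inequality against [code_prob] bounds the entropy by the mean of word cost plus reading
    cost. Three errors get a third of [e] each: noise in correct readings, misreadings on the
    exceptional set, and truncation of the last run. *)
Lemma join_entropy_le k (A : 'I_k -> set borel_cantor) (e : R) :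
  measurable_partition A -> 0 < e ->
  exists K, forall n, join_entropy full_shift nu A n <= n%:R * (escape_rate + e) + K.
Proof.
move=> PA e0; have [mA tA cA] := PA.
have [i0 _ _] : (\bigcup_i A i) (fun=> false) by rewrite cA.
have k0 : 0 < k%:R :> R := ord_bound_gt0 R k i0.
pose e' := e / 3; have e'0 : 0 < e' by rewrite divr_gt0.
(* Since [1 - eta = expR (- e')], a correct reading costs at most [e']. *)
pose eta := 1 - expR (- e').
have eta0 : 0 < eta by rewrite subr_gt0 expR_lt1 oppr_lt0.
have eta1 : eta < 1 by rewrite gtrBl expR_gt0.
(* The largest possible cost of a wrong reading. The exceptional set will have mass at most
   [e' / (L + 1)], so wrong readings cost at most [e'] on average. *)
pose L := - ln (eta / k%:R).
have L0 : 0 <= L.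
  rewrite oppr_ge0 ln_le0// ler_pdivrMr// mul1r.
  apply: (le_trans (ltW eta1)); rewrite ler1n.
  by apply: leq_ltn_trans (ltn_ord i0).
have L1 : 0 < L + 1 by rewrite ltr_wpDl.
have d0 : 0 < e' / (L + 1) by rewrite divr_gt0.
have [N [p [E [cp mE nuE AE]]]] := cylinder_approx_partition R nu k A _ PA d0.
have [K0 [K00 hK0]] := log_weight_sublinear _ e'0.
pose G (x : borel_cantor) : R := escape_cost R x + e' + L * \1_E x.
(* The [N] letters beyond time [n] cost at most 2 each; the rest bounds [log_weight (n + N)], the
   price of truncation. *)
pose C n := N%:R * 2 + (e' * (n + N)%:R + K0).
have mG : measurable_fun setT G.
  apply: measurable_funD; last exact: measurable_funM.
  by apply: measurable_funD => //; exact: measurable_escape_cost.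
have IG : \int[nu]_x G x <= escape_rate + 2 * e'.
  have iE : nu.-integrable setT (EFin \o escape_cost R).
    apply: (integrable_bounded _ 2); first exact: measurable_escape_cost.
    by move=> x; rewrite ger0_norm ?escape_cost_ge0//; exact: run_cost_le2.
  have iC : nu.-integrable setT (EFin \o (fun=> e' : R)).
    by apply: (integrable_bounded _ `|e'|) => // x.
  have i1 : nu.-integrable setT (EFin \o (\1_E : borel_cantor -> R)).
    apply: (integrable_bounded _ 1) => // x.
    by rewrite ger0_norm ?indicE; case: (_ \in _).
  have iL : nu.-integrable setT (EFin \o (fun x => L * \1_E x)).
    apply: (integrable_bounded _ L); first exact: measurable_funM.
    move=> x; rewrite ger0_norm ?mulr_ge0//.
    by apply: ler_piMr => //; rewrite indicE; case: (_ \in _).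
  rewrite RintegralD//; last exact: (integrableD measurableT iE iC).
  rewrite RintegralD// -/escape_rate -addrA lerD2l Rintegral_cst//.
  rewrite (_ : fine _ = 1); last by rewrite [X in fine X]probability_setT.
  rewrite RintegralZl// (_ : \int[nu]_x \1_E x = fine (nu E)); last first.
    by rewrite /Rintegral integral_indic// setIT.
  rewrite mulr1 mulr2n mulrDl mul1r lerD2l.
  apply: (@le_trans _ _ (L * (e' / (L + 1)))).
    apply: ler_wpM2l => //; rewrite -lee_fin fineK//; exact: fin_num_measure.
  rewrite mulrA ler_pdivrMr// mulrC ler_pM2l// lerDl//.
exists (N%:R * 2 + (e' * N%:R + K0)) => n.
have Cn0 : 0 <= C n by rewrite /C !addr_ge0 ?mulr_ge0 ?ler0n// ltW.
pose q := code_prob R k N p eta n.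
have q0 s : 0 < q s by exact: code_prob_gt0.
have sq : \sum_s q s <= 1 by exact: sum_code_prob.
have q1 s : q s <= 1.
  by apply: le_trans sq; rewrite (bigD1 s)//= lerDl sumr_ge0// => t _; exact/ltW.
apply: le_trans (gibbs_inequality _ _ _ q _ _ _) _ => //.
- by move=> s; exact: fine_ge0.
- by rewrite sum_join_block.
apply: le_trans (sum_join_block_le k A n _ G (2 + e' + L) (C n) PA mG _ Cn0 _ _) _.
- move=> x; have /andP[i0' i1'] : 0 <= L * \1_E x <= L.
    by rewrite indicE; case: (_ \in _); rewrite ?mulr1 ?mulr0 L0 lexx.
  have c0 := escape_cost_ge0 R x; have c2 : escape_cost R x <= 2 by exact: run_cost_le2.
  by rewrite /G; apply/andP; split; lra.
- by move=> s; rewrite oppr_ge0 ln_le0.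
- move=> s x Bx; apply: le_trans (ln_code_prob_le R k N p eta cp eta0 eta1 n s x) _.
  apply: (@le_trans _ _ (\sum_(i < n) escape_cost R (iter i full_shift x) + C n +
      \sum_(i < n) (e' + L * \1_E (iter i full_shift x)))); last first.
    rewrite addrAC lerD2r -big_split/= le_eqVlt; apply/orP; left; apply/eqP.
    by apply: eq_bigr => i _; rewrite /G addrA.
  apply: lerD.
    apply: le_trans (word_cost_le _ _ _) _; rewrite /C [leRHS]addrA.
    apply: lerD; last exact: hK0.
    rewrite big_split_ord/=; apply: lerD.
      apply: ler_sum => i _; rewrite /escape_cost.
      rewrite (_ : iter _ _ _ = fun m => x (i + m)%N)//.
      by apply/funext => m; exact: iter_full_shift.
    rewrite mulr_natl -[N in leRHS]card_ord -sumr_const; apply: ler_sum => i _.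
    exact: run_cost_le2.
  apply: ler_sum => i _; have [Ex|nEx] := pselect (E (iter i full_shift x)).
    rewrite indicE mem_set// mulr1 ler_wpDl ?(ltW e'0)// /L lerN2.
    by rewrite ler_ln ?posrE ?noisy_kernel_gt0 ?divr_gt0// noisy_kernel_ge.
  rewrite indicE memNset// mulr0 addr0.
  (* Off the exceptional set the code names the block actually visited, by disjointness of the
     blocks. *)
  have -> : s i = p (iter i full_shift x).
    by apply: (tA _ _ I I); exists (iter i full_shift x); split; [exact: Bx|exact: AE].
  rewrite lerNl -[leLHS]expRK ler_ln ?posrE ?noisy_kernel_gt0 ?expR_gt0//.
  by apply: le_trans (noisy_kernel_diag _ _ _ eta0 _); rewrite /eta opprB addrC subrK.
have : n%:R * \int[nu]_x G x <= n%:R * (escape_rate + 2 * e') by rewrite ler_wpM2l.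
rewrite /C natrD /e'; lra.
Qed.

End EntropyBound.

Section Invariant.
Variables (R : realType) (nu : probability borel_cantor R).

Lemma integrable_escape_cost : nu.-integrable setT (EFin \o escape_cost R).
Proof.
apply: (integrable_bounded R nu _ 2); first exact: measurable_escape_cost.
by move=> x; rewrite ger0_norm ?escape_cost_ge0//; exact: run_cost_le2.
Qed.

Lemma escape_rate_ge0 : 0 <= escape_rate R nu.
Proof. by apply: Rintegral_ge0 => x _; exact: escape_cost_ge0. Qed.

Lemma entropy_le_escape_rate : invariant_measure full_shift nu ->
  (entropy full_shift nu <= (escape_rate R nu)%:E)%E.
Proof.
move=> inu; apply: ge_ereal_sup => _ [k [A [PA ->]]]; rewrite lee_fin.
rewrite /partition_entropy; set u := (fun n : nat => _).
(* In the divergent case [limn] takes its default value 0. *)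
have [cu|/dvgP ->] := pselect (cvgn u); last exact: escape_rate_ge0.
apply/ler_addgt0Pr => e e0; have e20 : 0 < e / 2 by rewrite divr_gt0.
have [K hK] := join_entropy_le R nu inu k A _ PA e20.
apply: limr_le => //; near=> n.
have n0 : 0 < n%:R :> R by rewrite ltr0n; near: n; exact: nbhs_infty_gt.
rewrite /u ler_pdivrMr//; apply: le_trans (hK n) _.
have : K / (e / 2) <= n%:R by near: n; exact: nbhs_infty_ger.
by rewrite ler_pdivrMr// => ?; lra.
Unshelve. all: by end_near.
Qed.

End Invariant.

(** * The Dirac masses at the two fixed points *)

Section Dirac.
Variable R : realType.

Definition fixed_point (b : bool) : borel_cantor := fun=> b.

Definition fixed_measure (b : bool) : probability borel_cantor R :=
  dirac (fixed_point b).

Lemma fixed_measure_invariant b : invariant_measure full_shift (fixed_measure b).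
Proof. by []. Qed.

Lemma fixed_measure_ergodic b : ergodic_measure full_shift (fixed_measure b).
Proof.
split=> [|A _ _]; first exact: fixed_measure_invariant.
rewrite /fixed_measure/= diracE; case: (_ \in _); [by right|by left].
Qed.

Lemma fixed_measure_neq : ~ same_measure (fixed_measure false) (fixed_measure true).
Proof.
move=> /(_ [set x | x 0%N]); rewrite /fixed_measure/= !diracE.
rewrite memNset// mem_set// => H.
have : (0%:R%:E = 1%:R%:E :> \bar R)%E.
  apply: H; apply: (cylinder_measurable 1%N) => x y xy; by rewrite /= xy.
by case=> /eqP; rewrite eq_sym oner_eq0.
Qed.

Lemma Rintegral_fixed_measure b (g : borel_cantor -> R) :
  measurable_fun setT g -> \int[fixed_measure b]_x g x = g (fixed_point b).
Proof.
move=> mg; rewrite /Rintegral integral_dirac//; last exact/measurable_EFinP.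
by rewrite diracT mul1e.
Qed.

Lemma entropy_ge0 (nu : probability borel_cantor R) : (0 <= entropy full_shift nu)%E.
Proof.
(* The partition with a single block has entropy 0. *)
apply: ereal_sup_ubound; exists 1%N, (fun=> setT); split.
  split=> // [i j _ _ _|]; first by rewrite !ord1.
  by apply/seteqP; split=> // x _; exists ord0.
congr EFin; rewrite /partition_entropy (_ : (fun n => _) = cst 0) ?lim_cst//.
apply/funext => n /=; rewrite /join_entropy big1 ?mul0r// => s _.
rewrite (_ : join_block _ _ _ = setT); last by apply/seteqP; split.
by rewrite [X in fine X]probability_setT ln1 mulr0 oppr0.
Qed.

End Dirac.

(** * Uniform measures on periodic orbits *)

Section Orbit.
Variables (R : realType) (x : borel_cantor) (q : nat).

Definition orbit_measure : set borel_cantor -> \bar R :=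
  mscale (q.+1%:R^-1)%:nng
    (msum (fun i => \d_(iter i full_shift x) : measure borel_cantor R) q.+1).

HB.instance Definition _ := Measure.on orbit_measure.

Lemma orbit_measure_setT : orbit_measure setT = 1%E.
Proof.
rewrite /orbit_measure /mscale /= /msum /=.
under eq_bigr do rewrite diracT.
by rewrite sumEFin sumr_const card_ord -EFinM mulVf.
Qed.

HB.instance Definition _ :=
  Measure_isProbability.Build _ _ _ orbit_measure orbit_measure_setT.

Definition orbit_probability : probability borel_cantor R := orbit_measure.

(** Shifting trades the Dirac mass at time 0 for the one at time [q + 1], which is the same by
    periodicity. *)
Lemma orbit_probability_invariant : iter q.+1 full_shift x = x ->
  invariant_measure full_shift orbit_probability.
Proof.
move=> per A mA; rewrite /orbit_probability /= /orbit_measure /mscale /= /msum /=.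
congr (_ * _)%E; rewrite big_ord_recr big_ord_recl /= addeC; congr (_ + _)%E.
by rewrite !diracE -[in RHS]per.
Qed.

Lemma Rintegral_orbit (g : borel_cantor -> R) K :
  measurable_fun setT g -> (forall y, `|g y| <= K) ->
  \int[orbit_probability]_y g y =
  q.+1%:R^-1 * \sum_(i < q.+1) g (iter i full_shift x).
Proof.
move=> mg gK.
(* Adding [K] makes the function nonnegative, as the integration rules for scaled measures and sums
   of measures require. *)
have mgK : measurable_fun setT (fun y => g y + K) by exact: measurable_funD.
have g0 y : 0 <= g y + K by have := gK y; rewrite ler_norml => /andP[]; lra.
have E : \int[orbit_probability]_y (g y + K) =
    q.+1%:R^-1 * \sum_(i < q.+1) (g (iter i full_shift x) + K).
  rewrite /Rintegral ge0_integral_mscale//;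
    [|exact/measurable_EFinP|by move=> y _; rewrite lee_fin].
  rewrite ge0_integral_measure_sum//;
    [|by move=> y _; rewrite lee_fin|exact/measurable_EFinP].
  under eq_bigr => i _.
    rewrite integral_dirac//; last exact/measurable_EFinP.
    rewrite diracT mul1e. over.
  by rewrite sumEFin.
move: E; rewrite RintegralD//; first last.
- exact: (integrable_bounded _ _ _ `|K|).
- exact: (integrable_bounded _ _ _ K).
rewrite Rintegral_cst// (_ : fine _ = 1); last by rewrite [X in fine X]probability_setT.
rewrite big_split/= sumr_const card_ord mulrDr -(mulr_natl K) mulrA mulVf// mul1r mulr1.
exact: addIr.
Qed.

End Orbit.

(** * The coordinates steering the rotation vector *)

Section Steer.
Variable R : realType.

(** Single steps tend to 0, which gives continuity, yet over a run of [a] zeros they add up to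
    [sqrt a], which outgrows the logarithmic cost. *)
Definition sqrt_step (r : nat) : R := Num.sqrt r%:R - Num.sqrt r.-1%:R.

(** A following run of ones of length [2 i] pushes coordinate [i] up, one of length [2 i + 1] pushes
    it down; different coordinates use different lengths. *)
Definition signature (i j : nat) : R := (j == i.*2)%:R - (j == i.*2.+1)%:R.

(* [0^r 1^j 0 ...] is sent to [sqrt_step r * signature i j]. *)
Definition steer (i : nat) (x : cantor_space) : R :=
  if x 0%N then 0
  else sqrt_step (run x) * signature i (run (iter (run x) full_shift x)).

Lemma sqrt_step0 : sqrt_step 0 = 0. Proof. by rewrite /sqrt_step subrr. Qed.

Lemma sqrt_step_ge0 r : 0 <= sqrt_step r.
Proof. by rewrite subr_ge0 ler_sqrt ?ler0n// ler_nat leq_pred. Qed.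

Lemma sum_sqrt_step n : \sum_(r < n) sqrt_step r.+1 = Num.sqrt n%:R.
Proof.
elim: n => [|n IH]; first by rewrite big_ord0 sqrtr0.
by rewrite big_ord_recr /= IH /sqrt_step /= addrC subrK.
Qed.

(** For positive [r], replacing the second factor by [sqrt r + sqrt (r - 1)] gives exactly 1. *)
Lemma sqrt_step_mul_le1 r : sqrt_step r * Num.sqrt r%:R <= 1.
Proof.
case: r => [|r]; first by rewrite sqrt_step0 mul0r.
have s0 : 0 <= Num.sqrt r%:R :> R by exact: sqrtr_ge0.
have s1 : 0 <= Num.sqrt r.+1%:R :> R by exact: sqrtr_ge0.
have e0 : Num.sqrt r%:R ^+ 2 = r%:R :> R by rewrite sqr_sqrtr.
have e1 : Num.sqrt r.+1%:R ^+ 2 = r%:R + 1 :> R by rewrite sqr_sqrtr// natr1.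
have := sqrt_step_ge0 r.+1; rewrite /sqrt_step /=; nra.
Qed.

Lemma sqrt_step_cvg0 e : 0 < e -> exists N, forall r, (N < r)%N -> sqrt_step r < e.
Proof.
move=> e0; have e1 : 0 <= (e ^+ 2)^-1 by rewrite invr_ge0 exprn_ge0// ltW.
exists (Num.bound (e ^+ 2)^-1) => r Nr.
have re : (e ^+ 2)^-1 < r%:R.
  by apply: lt_trans (archi_boundP e1) _; rewrite ltr_nat.
have r0 : 0 < r%:R :> R by exact: le_lt_trans re.
have : e^-1 < Num.sqrt r%:R.
  rewrite -[ltLHS]ger0_norm ?invr_ge0 ?ltW// -sqrtr_sqr ltr_sqrt//.
  by rewrite exprVn.
have s0 : 0 < Num.sqrt r%:R :> R by rewrite sqrtr_gt0.
move=> H; have h1 : 1 < e * Num.sqrt r%:R by rewrite -ltr_pdivrMl// mulr1.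
have := le_lt_trans (sqrt_step_mul_le1 r) h1.
by rewrite ltr_pM2r.
Qed.

Lemma signature_norm i j : `|signature i j| <= 1.
Proof.
rewrite /signature; case: eqP => [->|_].
  by rewrite (_ : i.*2 == i.*2.+1 = false) ?subr0 ?normr1//; lia.
by case: eqP => _; rewrite sub0r normrN ?normr1 ?normr0.
Qed.

(** Long runs and infinite ones, coded by 0, must give the same value for continuity. For [i = 0]
    the code 0 would clash with the length [2 i]. *)
Lemma signature_large i j : (0 < i)%N -> j = 0 \/ (i.*2.+1 < j)%N -> signature i j = 0.
Proof.
move=> i0 h; rewrite /signature.
have -> : (j == i.*2) = false by lia.
by have -> : (j == i.*2.+1) = false; [lia|rewrite subrr].
Qed.

Lemma agree_iter n N (x y : borel_cantor) : agree (n + N) x y ->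
  agree N (iter n full_shift x) (iter n full_shift y).
Proof. by move=> h i iN; rewrite !iter_full_shift h// ltn_add2l. Qed.

(** At constant sequences [sqrt_step] tends to 0. If only the second run is infinite, the signature
    vanishes nearby. If both runs are finite, the function is locally constant. *)
Lemma steer_continuous i : (0 < i)%N -> continuous (steer i).
Proof.
move=> i0; apply: continuous_agreeP => x e e0.
have [x0|] := eqVneq (run x) 0%N.
  have [N hN] := sqrt_step_cvg0 _ e0; exists N.+1 => y xy.
  rewrite {1}/steer x0 sqrt_step0 mul0r if_same sub0r normrN.
  have [y0|y0] := run_agree_const _ _ _ x0 xy.
    by rewrite /steer y0 sqrt_step0 mul0r if_same normr0.
  rewrite /steer; case: (y 0%N); first by rewrite normr0.
  rewrite normrM (ger0_norm (sqrt_step_ge0 _)); apply: le_lt_trans (hN _ y0).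
  by rewrite ler_piMr ?sqrt_step_ge0// signature_norm.
rewrite -lt0n => r0.
have [j0|] := eqVneq (run (iter (run x) full_shift x)) 0%N.
  (* Agreement to this depth makes the second run of [y] infinite or longer than [2 i + 1]. *)
  exists (run x + i.*2.+2)%N => y xy.
  have ry : run y = run x by apply: run_agree r0 _; apply: agreeW xy; lia.
  have := run_agree_const _ _ _ j0 (agree_iter _ _ _ _ xy).
  move=> /(signature_large _ _ i0) sy.
  rewrite /steer ry sy mulr0 j0 signature_large ?mulr0; [|by []|by left].
  by rewrite !if_same subrr normr0.
rewrite -lt0n => j0.
exists (run x + (run (iter (run x) full_shift x)).+1)%N => y xy.
have ry : run y = run x by apply: run_agree r0 _; apply: agreeW xy; lia.
have y0 : y 0%N = x 0%N by apply: xy; lia.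
rewrite /steer ry y0 (run_agree _ (iter (run x) full_shift y) j0) ?subrr ?normr0//.
exact: agree_iter.
Qed.

Lemma steer_norm i x : `|steer i x| <= 1.
Proof.
rewrite /steer; case: (x 0%N); first by rewrite normr0.
rewrite normrM mulr_ile1// ?signature_norm// ger0_norm ?sqrt_step_ge0//.
case: (run x) => [|r]; first by rewrite sqrt_step0.
rewrite /sqrt_step /= lerBlDr.
have s0 : 0 <= Num.sqrt r%:R :> R by exact: sqrtr_ge0.
have s1 : 0 <= Num.sqrt r.+1%:R :> R by exact: sqrtr_ge0.
have e0 : Num.sqrt r%:R ^+ 2 = r%:R :> R by rewrite sqr_sqrtr.
have e1 : Num.sqrt r.+1%:R ^+ 2 = r%:R + 1 :> R by rewrite sqr_sqrtr// natr1.
nra.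
Qed.

Lemma steer_eq0 i x : escape_cost R x = 0 -> steer i x = 0.
Proof.
rewrite /steer /escape_cost => h; have -> : run x = 0%N.
  apply/eqP; apply: contraT; rewrite -lt0n => /(run_cost_gt0 R).
  by rewrite h ltxx.
by rewrite sqrt_step0 mul0r if_same.
Qed.

Lemma measurable_steer i : (0 < i)%N -> measurable_fun [set: borel_cantor] (steer i).
Proof. by move=> i0; apply: measurable_cantor_continuous; exact: steer_continuous. Qed.

End Steer.

(** * Integrals along the orbit of [(0^a 1^b)^oo] *)

Section BlockPoint.
Variables (R : realType) (a b : nat).
Hypotheses (a0 : (0 < a)%N) (b0 : (0 < b)%N).

Definition block_point : borel_cantor := fun t => (a <= t %% (a + b))%N.

Lemma block_point_periodic : iter (a + b) full_shift block_point = block_point.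
Proof.
by apply/funext => t; rewrite iter_full_shift /block_point modnDl.
Qed.

Lemma block_point_zero t : (t < a)%N -> block_point t = false.
Proof. by move=> ta; rewrite /block_point modn_small ?ltn_addr// leqNgt ta. Qed.

Lemma block_point_one t : (a <= t < a + b)%N -> block_point t = true.
Proof. by case/andP=> ta tb; rewrite /block_point modn_small. Qed.

Lemma run_block_zero t : (t < a)%N -> run (iter t full_shift block_point) = (a - t)%N.
Proof.
move=> ta; apply: run_eq => [i ir|]; rewrite !iter_full_shift addn0 (block_point_zero t)//.
  by rewrite block_point_zero//; lia.
by rewrite subnKC ?(ltnW ta)// block_point_one//; lia.
Qed.

Lemma run_block_one t : (t < b)%N -> run (iter (a + t) full_shift block_point) = (b - t)%N.
Proof.
move=> tb; apply: run_eq => [i ir|]; rewrite !iter_full_shift addn0 (block_point_one (a + t)); try lia.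
  by rewrite block_point_one//; lia.
rewrite (_ : a + t + (b - t) = a + b)%N; last lia.
by rewrite /block_point modnn leqNgt a0.
Qed.

Lemma sum_rev (h : nat -> R) n : \sum_(t < n) h (n - t)%N = \sum_(t < n) h t.+1.
Proof.
rewrite (reindex_inj rev_ord_inj)/=; apply: eq_bigr => t _; congr h.
by have := ltn_ord t; lia.
Qed.

Lemma sum_escape_block :
  \sum_(t < a + b) escape_cost R (iter t full_shift block_point) =
  log_weight R a + log_weight R b.
Proof.
rewrite big_split_ord/= -!sum_run_cost -!(sum_rev (run_cost R)).
congr (_ + _); apply: eq_bigr => t _; rewrite /escape_cost.
  by rewrite run_block_zero.
by rewrite run_block_one.
Qed.

(** Points starting with 1 contribute nothing. From each of the [a] zeros the next run is the full
    block of [b] ones, so the signature is constant and the steps telescope. *)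
Lemma sum_steer_block i :
  \sum_(t < a + b) steer R i (iter t full_shift block_point) =
  Num.sqrt a%:R * signature R i b.
Proof.
rewrite big_split_ord/= [X in _ + X]big1 => [|t _]; last first.
  by rewrite /steer iter_full_shift addn0 block_point_one//; have := ltn_ord t; lia.
rewrite addr0 -sum_sqrt_step -(sum_rev (sqrt_step R)) mulr_suml.
apply: eq_bigr => t _; have ta := ltn_ord t.
rewrite /steer iter_full_shift addn0 block_point_zero// run_block_zero//.
rewrite -iterD subnK ?(ltnW ta)//.
by have := run_block_one 0 b0; rewrite addn0 subn0 => ->.
Qed.

Definition block_measure : probability borel_cantor R :=
  orbit_probability R block_point (a + b).-1.

Lemma block_measure_invariant : invariant_measure full_shift block_measure.
Proof.
apply: orbit_probability_invariant; rewrite prednK ?block_point_periodic//; lia.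
Qed.

Lemma Rintegral_block_escape :
  \int[block_measure]_x escape_cost R x =
  (a + b)%:R^-1 * (log_weight R a + log_weight R b).
Proof.
rewrite (Rintegral_orbit _ _ _ _ 2); first 1 last.
- exact: measurable_escape_cost.
- by move=> y; rewrite ger0_norm ?escape_cost_ge0//; exact: run_cost_le2.
by rewrite prednK ?sum_escape_block//; lia.
Qed.

Lemma Rintegral_block_steer i : (0 < i)%N ->
  \int[block_measure]_x steer R i x =
  (a + b)%:R^-1 * (Num.sqrt a%:R * signature R i b).
Proof.
move=> i0; rewrite (Rintegral_orbit _ _ _ _ 1); first 1 last.
- exact: measurable_steer.
- exact: steer_norm.
by rewrite prednK ?sum_steer_block//; lia.
Qed.

End BlockPoint.

(** For [n = M ^ 4] the square root is [M ^ 2], while [log_weight n <= 8 ln (1 + M) <= 8 M] because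
    [n (n + 1) <= (M + 1) ^ 8]. Any [M] above [K] then suffices. *)
Lemma sqrt_dominates_log_weight (R : realType) (a b C : R) : 0 < a ->
  exists n, (0 < n)%N /\ b * (log_weight R n + C) < a * Num.sqrt n%:R.
Proof.
move=> a0; pose K := `|b| * (8 + `|C|) / a.
have K0 : 0 <= K by rewrite divr_ge0 ?mulr_ge0 ?addr_ge0// ltW.
pose M := (Num.bound K).+1.
have KM : K < M%:R.
  by apply: lt_trans (archi_boundP K0) _; rewrite ltr_nat.
have M1 : 1 <= M%:R :> R by rewrite ler1n.
exists (M ^ 4)%N; split; first by rewrite expn_gt0.
have -> : Num.sqrt (M ^ 4)%:R = M%:R ^+ 2 :> R.
  by rewrite natrX (exprM _ 2 2) sqrtr_sqr ger0_norm ?exprn_ge0.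
have lw : log_weight R (M ^ 4) <= 8 * M%:R.
  apply: (@le_trans _ _ (8 * ln (1 + M%:R))); last first.
    by rewrite ler_pM2l// le_ln1Dx// (lt_le_trans _ M1).
  rewrite mulr_natl -lnXn ?addr_gt0// /log_weight ler_ln ?posrE.
  - rewrite nat1r -natrX ler_nat (_ : M.+1 ^ 8 = M.+1 ^ 4 * M.+1 ^ 4)%N; last by rewrite -expnD.
    by apply: leq_mul; [rewrite leq_exp2r// leqnSn|rewrite ltn_exp2r].
  - by rewrite ltr0n muln_gt0 expn_gt0.
  - by rewrite exprn_gt0// addr_gt0.
have lw0 := log_weight_ge0 R (M ^ 4).
apply: (@le_lt_trans _ _ (`|b| * (8 + `|C|) * M%:R)).
  apply: le_trans (ler_norm _) _; rewrite normrM -mulrA ler_wpM2l//.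
  apply: le_trans (ler_normD _ _) _; rewrite ger0_norm// mulrDl lerD//.
  by rewrite ler_peMr.
rewrite expr2 mulrA ltr_pM2r ?(lt_le_trans _ M1)//.
by rewrite [ltRHS]mulrC -ltr_pdivrMr.
Qed.

(** * The rotation set at the origin *)

Section Main.
Variables (R : realType) (m : nat) (i0 : 'I_m).
Hypothesis i0E : i0 = 0%N :> nat.

(** The cost occupies coordinate 0, so the steering coordinates have positive index, as their
    continuity requires. *)
Definition potential (x : cantor_space) : 'rV[R]_m :=
  \row_(i < m) if i == i0 then - escape_cost R x else steer R i x.

Definition direction : 'rV[R]_m := delta_mx 0 i0.

Lemma dot_direction (u : 'rV[R]_m) : dot direction u = u 0 i0.
Proof.
rewrite /dot (bigD1 i0)//= big1 ?addr0 => [|i ii0]; rewrite mxE eqxx/=.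
  by rewrite eqxx mul1r.
by rewrite (negbTE ii0) mul0r.
Qed.

Lemma dot_potential x : dot direction (potential x) = - escape_cost R x.
Proof. by rewrite dot_direction mxE eqxx. Qed.

Lemma pos_index (i : 'I_m) : i != i0 -> (0 < i)%N.
Proof. by rewrite -val_eqE /= i0E lt0n. Qed.

Lemma row_continuous (g : cantor_space -> 'rV[R]_m) :
  (forall i, continuous (fun x => g x 0 i)) -> continuous g.
Proof.
move=> cg x; apply/cvg_ballP => e e0.
have h : \forall y \near x, forall i, ball (g x 0 i) e (g y 0 i).
  apply: (@filter_forall _ _ (fun i y => ball (g x 0 i) e (g y 0 i)) (nbhs x)
    (nbhs_filter x)) => i.
  by have /cvg_ballP := cg i x; exact.
near=> y; split=> // i j; rewrite ord1; move: j.
by near: y.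
Unshelve. all: by end_near.
Qed.

Lemma potential_continuous : continuous potential.
Proof.
apply: row_continuous => i.
rewrite (_ : (fun x => _) = if i == i0 then (fun x => - escape_cost R x) else steer R i).
  case: eqP => [_|/eqP ii0]; last by apply: steer_continuous; exact: pos_index.
  by move=> x; apply: cvgN; exact: escape_cost_continuous.
by apply/funext => x; rewrite mxE; case: ifP.
Qed.

Lemma Rintegral_scaled_potential (nu : probability borel_cantor R) (t : R) :
  \int[nu]_x (t * dot direction (potential x)) = - (t * escape_rate R nu).
Proof.
rewrite -mulNr -RintegralZl//; last exact: integrable_escape_cost.
by apply: eq_Rintegral => x _; rewrite dot_potential mulrN mulNr.
Qed.

Lemma rv_escape nu : rv potential nu 0 i0 = - escape_rate R nu.
Proof.
rewrite mxE; have := Rintegral_scaled_potential nu 1; rewrite mul1r => <-.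
by apply: eq_Rintegral => x _; rewrite mul1r dot_direction.
Qed.

Lemma rv_steer nu i : i != i0 -> rv potential nu 0 i = \int[nu]_x steer R i x.
Proof.
move=> ii0; rewrite mxE; apply: eq_Rintegral => x _.
by rewrite mxE (negbTE ii0).
Qed.

(** A nonnegative cost of integral 0 vanishes almost everywhere, and every steering coordinate
    vanishes where the cost does. *)
Lemma rv_eq0 nu : escape_rate R nu = 0 -> rv potential nu = 0.
Proof.
move=> e0; apply/rowP => i; rewrite [RHS]mxE.
have [->|ii0] := eqVneq i i0; first by rewrite rv_escape e0 oppr0.
rewrite rv_steer//.
have mE : measurable_fun [set: borel_cantor] (EFin \o escape_cost R).
  by apply/measurable_EFinP; exact: measurable_escape_cost.
have mS : measurable_fun [set: borel_cantor] (EFin \o steer R i).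
  by apply/measurable_EFinP; apply: measurable_steer; exact: pos_index.
have ae : ae_eq nu setT (EFin \o escape_cost R) (cst 0%E).
  apply/ae_eq_integral_abs => //.
  have <- : (\int[nu]_x (escape_cost R x)%:E)%E = 0%E.
    have := integrable_fin_num measurableT (integrable_escape_cost R nu).
    by move=> /fineK <-; congr EFin.
  by apply: eq_integral => x _; rewrite /= ger0_norm ?escape_cost_ge0.
rewrite /Rintegral (ae_eq_integral (cst 0%E))//; first by rewrite integral0.
apply: filterS ae => x h _; have [/steer_eq0 E] := h I.
by rewrite /= E.
Qed.

Lemma dot0r (u : 'rV[R]_m) : dot u 0 = 0.
Proof. by rewrite /dot big1// => i _; rewrite mxE mulr0. Qed.

Lemma escape_rate_fixed b : escape_rate R (fixed_measure R b) = 0.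
Proof.
rewrite /escape_rate Rintegral_fixed_measure; last exact: measurable_escape_cost.
by rewrite /escape_cost run_const// run_cost0.
Qed.

Lemma Rot0 : Rot potential 0.
Proof.
exists (fixed_measure R false); first exact: fixed_measure_invariant.
by apply: rv_eq0; exact: escape_rate_fixed.
Qed.

Lemma supporting0 : supporting_hyperplane potential direction 0.
Proof.
split; first by exists 0 => //; exact: Rot0.
move=> _ [_ [nu _ <-] <-]; rewrite dot0r dot_direction rv_escape oppr_le0.
exact: escape_rate_ge0.
Qed.

Lemma face_direction : face potential direction = [set 0].
Proof.
apply/seteqP; split=> [_ [[nu inu <-] [_ ub]]|_ ->]; last first.
  by split; [exact: Rot0|exact: supporting0].
apply: rv_eq0; apply/eqP; rewrite eq_le escape_rate_ge0 andbT -oppr_ge0 -rv_escape.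
by rewrite -dot_direction -(dot0r direction); apply: ub; exists 0 => //; exact: Rot0.
Qed.

(** The supporting inequality is tested on the orbit measure of [(0^a 1^b)^oo], and the common
    factor [1 / (a + b)] is cleared. *)
Lemma supporting_block beta a b : supporting_hyperplane potential beta 0 ->
  (0 < a)%N -> (0 < b)%N ->
  \sum_(i | i != i0) beta 0 i * (Num.sqrt a%:R * signature R i b) <=
  beta 0 i0 * (log_weight R a + log_weight R b).
Proof.
move=> [_ ub] a0 b0.
have : dot beta (rv potential (block_measure R a b)) <= 0.
  rewrite -(dot0r beta); apply: ub; exists (rv potential (block_measure R a b)) => //.
  by exists (block_measure R a b) => //; exact: block_measure_invariant.
rewrite /dot (bigD1 i0)//= rv_escape /escape_rate Rintegral_block_escape//.
rewrite (eq_bigr (fun i : 'I_m => (a + b)%:R^-1 *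
    (beta 0 i * (Num.sqrt a%:R * signature R i b)))); last first.
  by move=> i ii0; rewrite rv_steer// Rintegral_block_steer ?pos_index// mulrCA.
rewrite -mulr_sumr mulrN mulrCA -mulrN -mulrDr pmulr_rle0 ?invr_gt0 ?ltr0n ?addn_gt0 ?a0//.
by rewrite addrC subr_le0.
Qed.

Lemma sum_signature (beta : 'rV[R]_m) (i : 'I_m) (c : R) (neg : bool) : i != i0 ->
  \sum_(j | j != i0) beta 0 j * (c * signature R j (neg + i.*2)) =
  (-1) ^+ neg * beta 0 i * c.
Proof.
move=> ii0; rewrite (bigD1 i)//= big1 ?addr0 => [|j /andP[_ ji]].
  rewrite /signature; case: neg.
    rewrite add1n eqxx (_ : i.*2.+1 == i.*2 = false); first by rewrite expr1 /=; ring.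
    by lia.
  rewrite add0n eqxx (_ : i.*2 == i.*2.+1 = false); first by rewrite expr0 /=; ring.
  by lia.
have {}ji : (j : nat) <> i by move=> /val_inj ji'; rewrite ji' eqxx in ji.
have -> : signature R j (neg + i.*2) = 0.
  rewrite /signature.
  have -> : (neg + i.*2 == j.*2)%N = false by case: neg; lia.
  have -> : (neg + i.*2 == j.*2.+1)%N = false by case: neg; lia.
  by rewrite subrr.
by rewrite !mulr0.
Qed.

Lemma supporting_direction beta : unit_sphere beta ->
  supporting_hyperplane potential beta 0 -> beta = direction.
Proof.
move=> bb sb.
have b0 i : i != i0 -> beta 0 i = 0.
  move=> ii0; apply/eqP; apply: contraT => bi0.
  (* The block of ones gets length [2 i] or [2 i + 1] according to the sign of [beta 0 i], so that
     coordinate [i] contributes its absolute value times [sqrt n]; a long block of zeros then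
     violates the supporting inequality. *)
  pose neg := beta 0 i < 0.
  have abs : (-1) ^+ neg * beta 0 i = `|beta 0 i|.
    rewrite /neg; case: ltrP => h; first by rewrite expr1 mulN1r ltr0_norm.
    by rewrite expr0 mul1r ger0_norm.
  have p0 : 0 < `|beta 0 i| by rewrite normr_gt0.
  have [n [n0 hn]] := sqrt_dominates_log_weight R _ (beta 0 i0)
    (log_weight R (neg + i.*2)) p0.
  have j0 : (0 < neg + i.*2)%N by have := pos_index i ii0; lia.
  have := supporting_block beta n (neg + i.*2) sb n0 j0.
  by rewrite sum_signature// abs leNgt hn.
have sq : beta 0 i0 ^+ 2 = 1.
  rewrite -[RHS]bb /dot (bigD1 i0)//= big1 ?addr0 ?expr2// => i ii0.
  by rewrite b0// mul0r.
(* Only the two opposite unit vectors on the cost axis remain; the orbit of [(01)^oo], with positive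
   cost, rules out the negative one. *)
have nn : 0 <= beta 0 i0.
  have := supporting_block beta 1 1 sb isT isT.
  rewrite big1 => [|i ii0]; last by rewrite b0// mul0r.
  by rewrite pmulr_lge0// log_weight1 addr_gt0// ln_gt0// ltr1n.
apply/rowP => i; rewrite [RHS]mxE eqxx /=.
have [->|ii0] := eqVneq i i0; last by rewrite b0.
by apply/eqP; rewrite -sqrp_eq1// sq.
Qed.

(** Entropy is at most the mean cost, so entropy minus [t] times the mean cost is at most 0 for
    every invariant measure. At the fixed point the cost is 0 and the entropy nonnegative. *)
Lemma fixed_measure_equilibrium b (t : R) : 1 <= t ->
  equilibrium_states (fun x => t * dot direction (potential x)) (fixed_measure R b).
Proof.
move=> t1; split=> [|nu inu]; first exact: fixed_measure_invariant.
rewrite !Rintegral_scaled_potential escape_rate_fixed mulr0 oppr0 adde0.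
apply: le_trans (entropy_ge0 R _).
apply: (@le_trans _ _ ((escape_rate R nu)%:E + (- (t * escape_rate R nu))%:E)%E).
  by rewrite leeD2r// entropy_le_escape_rate.
by rewrite -EFinD lee_fin subr_le0 ler_peMl// escape_rate_ge0.
Qed.

Lemma fixed_measure_ground b :
  directional_ground_states potential direction (fixed_measure R b).
Proof.
split; first exact: fixed_measure_invariant.
(* The inverse temperatures start at 1, where the entropy bound begins to suffice; the equilibrium
   states are constant in [n]. *)
exists (fun n => n.+1%:R), (fun=> fixed_measure R b); split.
- by move=> n k; rewrite ler_nat.
- apply/cvgryPge => A; near=> n.
  apply: (@le_trans _ _ n%:R); last by rewrite ler_nat.
  by near: n; exact: nbhs_infty_ger.
- by move=> n; apply: fixed_measure_equilibrium; rewrite ler1n.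
- by move=> g _; exact: cvg_cst.
Unshelve. all: by end_near.
Qed.

End Main.

Theorem theoremB (R : realType) (m : nat) (m_gt0 : (0 < m)%N) :
  exists (Phi : cantor_space -> 'rV[R]_m) (w alpha : 'rV[R]_m),
    [/\ continuous Phi,
        Rot Phi w,
        unit_sphere alpha,
        smooth_exposed_point Phi w alpha &
        exists mu nu : probability borel_cantor R,
          [/\ directional_ground_states Phi alpha mu,
              directional_ground_states Phi alpha nu,
              ergodic_measure full_shift mu,
              ergodic_measure full_shift nu &
              ~ same_measure mu nu]].
Proof.
pose i0 := Ordinal m_gt0.
exists (potential R m i0), 0, (direction R m i0); split.
- exact: potential_continuous.
- exact: Rot0.
- by rewrite /unit_sphere /= dot_direction mxE !eqxx.
- split; first exact: face_direction.
  by move=> beta; exact: supporting_direction.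
exists (fixed_measure R false), (fixed_measure R true); split.
- exact: fixed_measure_ground.
- exact: fixed_measure_ground.
- exact: fixed_measure_ergodic.
- exact: fixed_measure_ergodic.
- exact: fixed_measure_neq.
Qed.
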